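(* For every integer $k\ge 3$ the generating function $F_{21\text{-}3\text{-}\cdots\text{-}k;r}(x)$, $0\le r\le k-2$, is a rational function given by $$F_{21\text{-}3\text{-}\cdots\text{-}k;r}(x)=\frac{x^{\frac{r-1}{2}}\,U_{k-1}^{\,r-1}\!\left(\frac1{2\sqrt x}\right)}{U_k^{\,r+1}\!\left(\frac1{2\sqrt x}\right)}\qquad (1\le r\le k-2),$$ $$F_{21\text{-}3\text{-}\cdots\text{-}k;0}(x)=\frac{U_{k-1}\!\left(\frac1{2\sqrt x}\right)}{\sqrt x\,U_k\!\left(\frac1{2\sqrt x}\right)},$$ where $U_j$ is the $j$th Chebyshev polynomial of the second kind.
   Context: Generalized patterns: a generalized pattern is a permutation $\tau=\tau_1\cdots\tau_k$ of $\{1,\dots,k\}$ written with dashes between some of its adjacent letters. An occurrence of $\tau$ in $\pi=\pi_1\cdots\pi_n\in S_n$ is a choice of positions $i_1<\dots<i_k$ such that $(\pi_{i_1},\dots,\pi_{i_k})$ is order-isomorphic to $(\tau_1,\dots,\tau_k)$ and $i_{j+1}=i_j+1$ whenever there is no dash between $\tau_j$ and $\tau_{j+1}$. The pattern $21\text{-}3\text{-}\cdots\text{-}k$ requires only the first two letters to be adjacent in $\pi$. A permutation is $1\text{-}3\text{-}2$-avoiding if it has no occurrence of the classical (fully dashed) pattern $1\text{-}3\text{-}2$. $f_{\tau;r}(n)$ is the number of $1\text{-}3\text{-}2$-avoiding permutations in $S_n$ containing exactly $r$ occurrences of $\tau$ (with $S_0$ consisting of the empty permutation), and $F_{\tau;r}(x)=\sum_{n\ge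 0} f_{\tau;r}(n)x^n$. Chebyshev polynomials of the second kind: $U_j(\cos\theta)=\sin((j+1)\theta)/\sin\theta$. The exponents on $U$ denote powers. *)

(* Defs.v *)
From mathcomp Require Import all_boot all_order all_algebra all_fingroup.
From mathcomp Require Import all_classical all_reals.
From mathcomp Require Import sequences exp trigo.
From mathcomp Require Import ring.

Set Implicit Arguments.
Unset Strict Implicit.
Unset Printing Implicit Defensive.

Import Order.TTheory GRing.Theory Num.Theory.
Local Open Scope ring_scope.

(* With 0-based indices, nth true dashes j says whether there is a dash between
   the j-th and the (j+1)-st letters. *)
Record gpattern := GPattern {
  letters : seq nat;
  dashes : bitseq;
  lettersP : perm_eq letters (iota 1 (size letters));
  size_dashes : size dashes = (size letters).-1
}.

Definition occurrence (tau : gpattern) (n : nat) (pi : 'S_n)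
    (i : {ffun 'I_(size (letters tau)) -> 'I_n}) : bool :=
  [forall a : 'I_(size (letters tau)), forall b : 'I_(size (letters tau)),
    [&& (a < b)%N ==> (i a < i b)%N,
        (pi (i a) < pi (i b))%N
          == (nth 0%N (letters tau) a < nth 0%N (letters tau) b)%N
      & ((b == a.+1 :> nat) && ~~ nth true (dashes tau) a)
          ==> (i b == (i a).+1 :> nat)]].

Definition nb_occ (tau : gpattern) (n : nat) (pi : 'S_n) : nat :=
  #|[set i | @occurrence tau n pi i]|.

Definition avoids (tau : gpattern) (n : nat) (pi : 'S_n) : bool :=
  [forall i, ~~ @occurrence tau n pi i].

Definition pat132 : gpattern :=
  @GPattern [:: 1; 3; 2]%N [:: true; true] erefl erefl.

Lemma pat213_lettersP (k : nat) :
  perm_eq [:: 2, 1 & iota 3 (k - 2)]%N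
    (iota 1 (size [:: 2, 1 & iota 3 (k - 2)]%N)).
Proof. by rewrite /= size_iota (perm_catCA [:: 2%N] [:: 1%N]). Qed.

Lemma pat213_size_dashes (k : nat) :
  size (false :: nseq (k - 2) true) = (size [:: 2, 1 & iota 3 (k - 2)]%N).-1.
Proof. by rewrite /= size_nseq size_iota. Qed.

(* 21-3-...-k, for k >= 2 *)
Definition pat213 (k : nat) : gpattern :=
  GPattern (pat213_lettersP k) (pat213_size_dashes k).

Definition f_ (tau : gpattern) (r n : nat) : nat :=
  #|[set pi : 'S_n | avoids pat132 pi && (nb_occ tau pi == r)]|.

(* The quotient P / Q is well defined as a formal power series, and
   \sum_n a n x^n = P / Q. *)
Definition fps_quotient (R : realType) (a : nat -> nat) (P Q : {poly R}) : Prop :=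
  Q`_0 != 0 /\
  forall n : nat, \sum_(i < n.+1) Q`_i * (a (n - i)%N)%:R = P`_n.

(* \sum_n a n x^n is a rational function whose value at every x > 0 satisfying
   D x is E x.  D is meant to exclude the poles of E: if it holds for infinitely
   many x > 0, then a is determined by E. *)
Definition genfun_eq (R : realType) (a : nat -> nat) (D : R -> Prop)
    (E : R -> R) : Prop :=
  exists P Q : {poly R}, fps_quotient a P Q /\
    forall x : R, 0 < x -> D x -> Q.[x] != 0 /\ P.[x] / Q.[x] = E x.

Definition is_chebyshevU (R : realType) (j : nat) (p : {poly R}) : Prop :=
  forall theta : R, sin theta != 0 ->
    p.[cos theta] = sin (j.+1%:R * theta) / sin theta.

(* The value 0 is never used: see chebyshevUP. *)
Definition chebyshevU (R : realType) (j : nat) : {poly R} :=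
  xget 0 [set p | is_chebyshevU j p]%classic.

Lemma is_chebyshevU_exists (R : realType) (j : nat) :
  exists p : {poly R}, is_chebyshevU j p.
Proof.
suff [p [q [hp _]]] : exists p q : {poly R},
    is_chebyshevU j p /\ is_chebyshevU j.+1 q by exists p.
elim: j => [|j [p [q [hp hq]]]].
  exists 1, (2%:P * 'X); split=> t st; first by rewrite hornerC mul1r divff.
  have -> : (2%:R * t : R) = t *+ 2 by rewrite mulr_natl.
  by rewrite !hornerE sin_mulr2n -mulrnAl mulfK // mulr_natl.
exists q, (2%:P * 'X * q - p); split=> // t st.
rewrite !hornerE hp // hq //; apply: (mulIf st).
rewrite mulrBl -!mulrA mulVf // !mulr1.
have -> : (j.+3%:R * t : R) = j.+2%:R * t + t by rewrite -addn1 natrD mulrDl mul1r.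
have -> : (j.+1%:R * t : R) = j.+2%:R * t - t.
  by rewrite -[j.+2]addn1 natrD mulrDl mul1r addrK.
rewrite !sinD sinN cosN; ring.
Qed.

Lemma chebyshevUP (R : realType) (j : nat) : is_chebyshevU j (chebyshevU R j).
Proof.
by rewrite /chebyshevU; case: xgetP => // h; case: (is_chebyshevU_exists R j) => p /h.
Qed.

Definition U_at (R : realType) (j : nat) (x : R) : R :=
  (chebyshevU R j).[1 / (2 * Num.sqrt x)].

(* Main.v *)
Require Import Defs.
From mathcomp Require Import all_boot all_order all_algebra all_fingroup.
From mathcomp Require Import all_classical all_reals.
From mathcomp Require Import sequences exp trigo.
From mathcomp Require Import zify ring.

Import Order.TTheory GRing.Theory Num.Theory.
Local Open Scope ring_scope.

(** In a 132-avoiding permutation the letters that follow [pi_p] and exceed it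
    increase, so an occurrence of 21-3-...-k is a descent [p] together with any
    [m = k - 2] of these letters: their number is the sum over the descents [p]
    of ['C(g_p, m)], [g_p] counting the later larger letters.

    A nonempty 132-avoiding word is [l n r] with [l > r].  Inside [l] the
    maximum [n] raises every [g_p] by one, so we count with the weight
    [W_j = \sum_p 'C(j + g_p, m)], which satisfies
    [W_j (l n r) = W_(j+1) l + W_j r + (r != [::]) * 'C(j, m)].  Hence
    [G_j = \sum_s x^|s| q^(W_j s)] satisfies
    [G_j = 1 + x G_(j+1) (1 + q^'C(j, m) (G_j - 1))].  Modulo [q^(m+1)] this is
    [(1 - x) G_j = 1] for [j > m], and downward induction on [j] gives
    [G_0 = (V_(m+1) - x q V_m) / (V_(m+2) - x q V_(m+1))] with
    [V_i(x) = x^(i/2) U_i(1 / (2 sqrt x))].  The coefficient of [q^r] follows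
    from [V_(m+1)^2 - V_m V_(m+2) = x^(m+1)]. *)

(** * Decomposition of 132-avoiding words at their maximum *)

Section Words.
Local Open Scope nat_scope.
Implicit Types (s l r : seq nat).

Definition stdword s : bool := perm_eq s (iota 0 (size s)).

Fixpoint avoids132 s : bool :=
  if s is x :: s' then
    pairwise (fun y z => ~~ (x < z < y)) s' && avoids132 s'
  else true.

(* [j] stands for larger letters placed after the whole word. *)
Fixpoint weight (m j : nat) s : nat :=
  if s is x :: s' then
    (head x s' < x) * 'C(j + count (ltn x) s', m) + weight m j s'
  else 0.

(** The shift by [size r] puts [l] above [r] and below the new maximum, so standard words glue to a
    standard word. *)
Definition glue l r : seq nat :=
  [seq size r + x | x <- l] ++ (size l + size r) :: r.

(* [h] bounds the number of nested [glue]s, hence any word of size at most [h]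
   is reached, together with some longer ones: see [mem_avoiders]. *)
Fixpoint avoiders (h : nat) : seq (seq nat) :=
  [::] :: if h is h'.+1 then [seq glue l r | l <- avoiders h', r <- avoiders h']
          else [::].

Lemma stdword_lt s x : stdword s -> x \in s -> x < size s.
Proof. by move=> /perm_mem ->; rewrite mem_iota. Qed.

Lemma size_glue l r : size (glue l r) = (size l + size r).+1.
Proof. by rewrite size_cat size_map /= addnS. Qed.

Lemma stdword_glue l r : stdword l -> stdword r -> stdword (glue l r).
Proof.
rewrite /stdword size_glue => /(perm_map (addn (size r))) hl hr.
rewrite -iotaDl addn0 in hl.
rewrite -addn1 (addnC (size l)) !iotaD !add0n /glue -cat1s catA perm_catC.
rewrite -[X in perm_eq _ X]catA (addnC (size l)).
by do 2!apply: perm_cat => //.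
Qed.

Lemma weight_shift m j c s : weight m j [seq c + x | x <- s] = weight m j s.
Proof.
elim: s => //= x s ->; rewrite count_map; congr (_ * 'C(_ + _, _) + _).
  by case: s => [|y s] /=; rewrite ?ltnn ?ltn_add2l.
by apply: eq_count => y /=; rewrite ltn_add2l.
Qed.

(** For each letter of [l], [n] is one more later larger letter and [r] adds none, so [j] grows by
    one. The last letter of [l] is followed by [n] and stays a non-descent; [n] is a descent unless
    [r] is empty. *)
Lemma weight_cat m j n l r : all (gtn n) l -> all (gtn n) r ->
  allrel (fun x y => y < x) l r ->
  weight m j (l ++ n :: r) =
    weight m j.+1 l + (r != [::]) * 'C(j, m) + weight m j r.
Proof.
move=> ln rn; elim: l ln => [_ _|x l IH /= /andP[xn ln]]/=.
  congr (_ * 'C(_, _) + _); last first.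
    rewrite -[RHS]addn0; congr addn; apply/eqP; rewrite eqn0Ngt -has_count.
    by apply/hasPn => y /(allP rn) /=; rewrite -leqNgt => /ltnW.
  by case: r rn => [|y r] /=; rewrite ?ltnn // => /andP[->].
rewrite allrel_consl => /andP[xr lr]; rewrite IH // !addnA.
congr (_ * 'C(_, _) + _ + _ + _).
  by case: l {IH ln lr} => //=; rewrite ltnn ltnNge ltnW.
rewrite count_cat /= xn.
suff -> : count (ltn x) r = 0 by rewrite !addnS addn0 addSn.
apply/eqP; rewrite eqn0Ngt -has_count; apply/hasPn => y /(allP xr) /=.
by rewrite -leqNgt => /ltnW.
Qed.

Lemma glue_bounds l r : stdword l -> stdword r ->
  [/\ all (gtn (size l + size r)) [seq size r + x | x <- l],
      all (gtn (size l + size r)) r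
    & allrel (fun x y => y < x) [seq size r + x | x <- l] r].
Proof.
move=> hl hr; split.
- rewrite all_map; apply/allP => x /(stdword_lt _ _ hl) /=.
  by rewrite addnC ltn_add2r.
- by apply/allP => x /(stdword_lt _ _ hr) /= xr; rewrite ltn_addl.
- by apply/allrelP => _ y /mapP[x xl ->] /(stdword_lt _ _ hr) yr; rewrite ltn_addr.
Qed.

Lemma weight_glue m j l r : stdword l -> stdword r ->
  weight m j (glue l r) =
    weight m j.+1 l + (r != [::]) * 'C(j, m) + weight m j r.
Proof.
by move=> hl hr; have [? ? ?] := glue_bounds l r hl hr;
  rewrite weight_cat // weight_shift.
Qed.

Lemma avoids132_shift c s : avoids132 [seq c + x | x <- s] = avoids132 s.
Proof.
elim: s => //= x s ->; rewrite pairwise_map; congr (_ && _).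
by apply: eq_pairwise => y z /=; rewrite !ltn_add2l.
Qed.

(** An occurrence cannot start in [l] and end outside it: its last letter would be smaller than its
    first, or be the maximum [n]. None starts at [n]. *)
Lemma avoids132_cat n l r : all (gtn n) l -> all (gtn n) r ->
  allrel (fun x y => y < x) l r ->
  avoids132 (l ++ n :: r) = avoids132 l && avoids132 r.
Proof.
move=> ln rn; elim: l ln => [_ _|x l IH /= /andP[xn ln]]/=.
  suff -> : pairwise (fun y z => ~~ (n < z < y)) r by [].
  have: pairwise (fun y z => true) r
    by elim: r {rn} => //= y r ->; rewrite all_predT.
  apply: (sub_in_pairwise (P := gtn n)) rn => y z _ zn _ /=.
  by rewrite ltnNge ltnW.
rewrite allrel_consl => /andP[xr lr]; rewrite IH // andbA; congr (_ && _).
rewrite pairwise_cat /=.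
have -> : all (fun z => ~~ (x < z < n)) r.
  by apply/allP => z /(allP xr) zx; rewrite ltnNge ltnW.
have -> : pairwise (fun y z => ~~ (x < z < y)) r.
  have: pairwise (fun y z => true) r
    by elim: r {rn IH xr lr} => //= y r ->; rewrite all_predT.
  apply: (sub_in_pairwise (P := gtn x)) xr => y z _ zn _ /=.
  by rewrite ltnNge ltnW.
suff -> : allrel (fun y z => ~~ (x < z < y)) l (n :: r) by rewrite /= andbT.
apply/allrelP => y z yl; rewrite inE => /orP[/eqP->|/(allP xr) zx].
  by rewrite negb_and orbC -leqNgt ltnW //; exact: (allP ln _ yl).
by rewrite ltnNge ltnW.
Qed.

Lemma stdword_split n s : stdword s -> avoids132 s -> size s = n.+1 ->
  exists l r, [/\ s = glue l r, stdword l, avoids132 l, stdword r & avoids132 r].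
Proof.
move=> std av sz.
have us : uniq s by rewrite (perm_uniq std) iota_uniq.
have ns : n \in s by rewrite (perm_mem std) mem_iota sz add0n ltnSn.
have sn x : x \in s -> x <= n by move=> /(stdword_lt _ _ std); rewrite sz.
case/splitPr: ns => l r in std av sz us sn *.
have szn : n = size r + size l by move: sz; rewrite size_cat /= addnS addnC => -[].
move: (us); rewrite cat_uniq /= negb_or => /and3P[ul /andP[nl lr] /andP[nr ur]].
have ln : all (gtn n) l.
  apply/allP => x xl /=; rewrite ltn_neqAle sn ?mem_cat ?xl // andbT.
  by apply: contraNneq nl => <-.
have rn : all (gtn n) r.
  apply/allP => x xr /=; rewrite ltn_neqAle sn ?mem_cat ?inE ?xr ?orbT // andbT.
  by apply: contraNneq nr => <-.
have rl : allrel (fun x y => y < x) l r.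
  apply/allrelP => x y xl yr; rewrite ltnNge leq_eqVlt negb_or.
  have -> /= : x != y.
    by apply: contraNneq lr => xy; apply/hasP; exists y; rewrite // -xy.
  (* The part of the word starting at [x] still contains [n] and then [y], so [x < y < n] would make
     [x n y] a 1-3-2. *)
  elim: l xl av {std sz us sn szn ul nl lr ln} => //= z l IH.
  rewrite inE => /orP[/eqP<- {IH}|/IH h] /andP[+ av]; last by move=> _; apply: h.
  rewrite pairwise_cat /= => /and4P[_ _ /allP /(_ y yr) + _].
  by rewrite (allP rn _ yr : y < n) andbT.
have [avl avr] : avoids132 l /\ avoids132 r.
  by apply/andP; rewrite -(@avoids132_cat n).
(* As [r < l] letterwise, sorting [r] and [l] separately sorts their union. *)
have : sort leq r ++ sort leq l = iota 0 (size r) ++ iota (size r) (size l).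
  rewrite -[X in iota X (size l)]add0n -iotaD.
  apply: (sorted_eq leq_trans anti_leq); last 1 first.
  - rewrite -szn -(perm_cons n) perm_sym -cat1s perm_catC -[n in X in _ ++ X]add0n.
    rewrite -(iotaD 0 n 1) addn1 perm_sym.
    move: std; rewrite /stdword sz; apply: perm_trans.
    rewrite perm_sym -(cat1s n r) perm_catCA perm_cons perm_catC.
    by apply: perm_cat; rewrite perm_sym perm_sort.
  - rewrite sorted_pairwise; last exact: leq_trans.
    rewrite pairwise_cat -!sorted_pairwise; [|exact: leq_trans..].
    rewrite !(sort_sorted leq_total) !andbT; apply/allrelP => y x.
    by rewrite !mem_sort => yr xl; apply: ltnW; apply: (allrelP rl).
  - exact: iota_sorted.
move/eqP; rewrite eqseq_cat ?size_sort ?size_iota // => /andP[/eqP er /eqP el].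
have stdr : stdword r by rewrite /stdword -er perm_sym perm_sort.
have lge x : x \in l -> size r <= x.
  by rewrite -(mem_sort leq) el mem_iota => /andP[].
have ll : l = [seq size r + x | x <- [seq y - size r | y <- l]].
  rewrite -map_comp -[LHS]map_id; apply/eq_in_map => x /lge rx /=.
  by rewrite subnKC.
exists [seq y - size r | y <- l], r; split=> //.
- by rewrite /glue -ll size_map addnC -szn.
- rewrite /stdword size_map; apply: (perm_map_inj (@addnI (size r))); rewrite -ll.
  by rewrite -iotaDl addn0 -el perm_sym perm_sort.
- by rewrite -(avoids132_shift (size r)) -ll.
Qed.

(** The maximum sits at index [size l], so the word itself shows where to cut. *)
Lemma glue_inj l r l' r' :
  stdword l -> stdword r -> stdword l' -> stdword r' ->
  glue l r = glue l' r' -> l = l' /\ r = r'.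
Proof.
move=> hl hr hl' hr' e.
have : size (glue l r) = size (glue l' r') by rewrite e.
rewrite !size_glue => -[en].
have idx a b : stdword a -> stdword b ->
    index (size a + size b) (glue a b) = size a.
  move=> ha hb; have [/allP bnd _ _] := glue_bounds a b ha hb.
  rewrite index_cat /= eqxx addn0 size_map ifN //.
  by apply/negP => /bnd /=; rewrite ltnn.
have el : size l = size l' by rewrite -(idx l r) // -(idx l' r') // e en.
have er : size r = size r' by apply: (@addnI (size l)); rewrite en el.
move/eqP: e; rewrite /glue eqseq_cat ?size_map // => /andP[/eqP e1 /eqP[_ e2]].
split=> //; move: e1; rewrite e2; apply: inj_map; exact: addnI.
Qed.

Lemma avoiders_valid h s : s \in avoiders h -> stdword s && avoids132 s.
Proof.
elim: h s => [|h IH] s; first by rewrite inE => /eqP->.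
rewrite inE => /predU1P[->//|].
case/allpairsP => -[l r] /= [/IH/andP[hl al] /IH/andP[hr ar] ->].
rewrite stdword_glue //=; have [? ? ?] := glue_bounds l r hl hr.
by rewrite avoids132_cat // avoids132_shift al.
Qed.

Lemma mem_avoiders h s : size s <= h ->
  (s \in avoiders h) = stdword s && avoids132 s.
Proof.
move=> sh; apply/idP/idP; first exact: avoiders_valid.
elim: h s sh => [|h IH] s sh /andP[std av]; first by case: s sh {std av}.
case e : (size s) => [|n]; first by rewrite (size0nil e) mem_head.
have [l [r [sE hl al hr ar]]] := stdword_split n s std av e.
move: sh; rewrite sE size_glue ltnS => sh.
rewrite inE; apply/orP; right; apply: allpairs_f; apply: IH; rewrite ?hl ?hr //.
  by apply: leq_trans sh; rewrite leq_addr.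
by apply: leq_trans sh; rewrite leq_addl.
Qed.

Lemma avoiders_uniq h : uniq (avoiders h).
Proof.
elim: h => //= h IH; apply/andP; split.
  by apply/negP => /allpairsP[[l r] [_ _]] /(congr1 size); rewrite size_glue.
apply: allpairs_uniq => // -[l r] [l' r'] /allpairsP[[? ?] [/= h1 h2 [-> ->]]].
move=> /allpairsP[[? ?] [/= h3 h4 [-> ->]]] /= e.
have v a : a \in avoiders h -> stdword a by move=> /avoiders_valid/andP[].
by have [-> ->] := glue_inj _ _ _ _ (v _ h1) (v _ h2) (v _ h3) (v _ h4) e.
Qed.

End Words.

(** * Permutations as standard words *)

Section Permutations.
Local Open Scope nat_scope.

Lemma avoids132P s :
  reflect (forall i j l, i < j -> j < l -> l < size s ->
             ~~ (nth 0 s i < nth 0 s l < nth 0 s j))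
          (avoids132 s).
Proof.
elim: s => [|x s IH]; first by constructor.
apply: (iffP andP) => [[/(pairwiseP 0) px /IH ps] [|i] [|j] [|l] //= ij jl ls|h].
- by apply: px => //; rewrite inE; apply: ltn_trans (ls : l < size s).
- exact: ps.
- split; last by apply/IH => i j l ij jl ls; apply: (h i.+1 j.+1 l.+1).
  by apply/(pairwiseP 0) => j l _ ls jl; apply: (h 0 j.+1 l.+1).
Qed.

Lemma weightE m j s : weight m j s =
  \sum_(p < size s) ((p.+1 < size s) && (nth 0 s p.+1 < nth 0 s p)) *
    'C(j + count (fun x => (p < x) && (nth 0 s p < nth 0 s x))
                 (iota 0 (size s)), m).
Proof.
elim: s => [|x s IH]; first by rewrite big_ord0.
rewrite [LHS]/= big_ord_recl IH; congr (_ * 'C(_ + _, _) + _).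
(* At the last letter the default [x] of [head] gives [x < x], which is false like the guard on
   [p.+1]. *)
- by case: s {IH} => [|y s] //=; rewrite ltnn.
- rewrite /= add0n (iotaDl 1 0) count_map -[X in count _ X](mkseq_nth 0) count_map.
  by apply: eq_count => y.
- apply: eq_bigr => p _ /=; rewrite ltnS; congr (_ * 'C(_ + _, _)).
  by rewrite add0n (iotaDl 1 0) count_map.
Qed.

Section Perm.
Variables (n : nat) (pi : 'S_n).

Definition perm_word : seq nat := [seq val (pi i) | i <- enum 'I_n].

Lemma size_perm_word : size perm_word = n.
Proof. by rewrite size_map size_enum_ord. Qed.

Lemma nth_perm_word (i : 'I_n) : nth 0 perm_word i = pi i.
Proof. by rewrite (nth_map i) ?size_enum_ord // nth_ord_enum. Qed.

Lemma stdword_perm_word : stdword perm_word.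
Proof.
rewrite /stdword size_perm_word -val_enum_ord /perm_word (map_comp val pi).
apply/perm_map/uniq_perm; [|exact: enum_uniq|].
  by rewrite map_inj_uniq ?enum_uniq //; exact: perm_inj.
by move=> x; rewrite mem_enum -[x](permKV pi) map_f // mem_enum.
Qed.

(** The letters of [tau] are distinct, so preserving their strict order already yields the
    equivalence in [occurrence]. *)
Lemma occurrenceP (tau : gpattern)
    (i : {ffun 'I_(size (letters tau)) -> 'I_n}) :
  reflect
    [/\ forall a b : 'I_(size (letters tau)), a < b -> i a < i b,
        forall a b : 'I_(size (letters tau)),
          nth 0 (letters tau) a < nth 0 (letters tau) b -> pi (i a) < pi (i b)
      & forall a b : 'I_(size (letters tau)),
          b = a.+1 :> nat -> ~~ nth true (dashes tau) a -> i b = (i a).+1 :> nat]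
    (occurrence pi i).
Proof.
apply: (iffP forallP) => [h|[h1 h2 h3] a].
  have {}h a b := forallP (h a) b.
  split=> a b.
  - by case/and3P: (h a b) => /implyP.
  - by case/and3P: (h a b) => _ /eqP ->.
  - by case/and3P: (h a b) => _ _ /implyP hb ab d; apply/eqP/hb; rewrite ab eqxx.
apply/forallP => b; apply/and3P; split; first exact/implyP/h1.
- have [/h2->//|lba|] := ltngtP (nth 0 (letters tau) a) (nth 0 (letters tau) b).
    by rewrite ltnNge ltnW // h2.
  have ul : uniq (letters tau) by rewrite (perm_uniq (lettersP tau)) iota_uniq.
  by move/eqP; rewrite nth_uniq // => /eqP/val_inj ->; rewrite ltnn.
- by apply/implyP => /andP[/eqP hb d]; apply/eqP/h3.
Qed.

Lemma avoids_pat132E : avoids pat132 pi = avoids132 perm_word.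
Proof.
apply/forallP/avoids132P => [h i j l ij jl|h i].
  rewrite size_perm_word => ln.
  have jn := ltn_trans jl ln; have i_n := ltn_trans ij jn.
  rewrite -[i]/(val (Ordinal i_n)) -[j]/(val (Ordinal jn)) -[l]/(val (Ordinal ln)).
  rewrite !nth_perm_word; apply/negP => /andP[il lj].
  have lij := ltn_trans il lj; have ijl := ltn_trans ij jl.
  have/occurrenceP := h [ffun a : 'I_(size (letters pat132)) =>
                         nth (Ordinal i_n) [:: Ordinal i_n; Ordinal jn; Ordinal ln] a].
  apply; split=> a b.
  - by rewrite !ffunE; case: a b => [[|[|[|?]]] ?] [[|[|[|?]]] ?].
  - by rewrite !ffunE; case: a b => [[|[|[|?]]] ?] [[|[|[|?]]] ?].
  - by case: a => [[|[|[|?]]] ?].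
apply/negP => /occurrenceP[oc1 oc2 _].
pose o (a : 'I_3) : 'I_(size (letters pat132)) := a.
have h01 := oc1 (o (inord 0)) (o (inord 1)).
have h12 := oc1 (o (inord 1)) (o (inord 2)).
have p02 := oc2 (o (inord 0)) (o (inord 2)).
have p21 := oc2 (o (inord 2)) (o (inord 1)).
move: h01 h12 p02 p21; rewrite /= !inordK //.
move=> /(_ isT) h01 /(_ isT) h12 /(_ isT) p02 /(_ isT) p21.
have := h (i (o (inord 0))) (i (o (inord 1))) (i (o (inord 2))) h01 h12.
by rewrite size_perm_word !nth_perm_word p02 p21 ltn_ord => /(_ isT).
Qed.
End Perm.

Lemma perm_word_inj n : injective (@perm_word n).
Proof.
by move=> pi pi' e; apply/permP => i; apply: val_inj; rewrite /= -!nth_perm_word e.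
Qed.

Lemma perm_word_surj s : stdword s -> exists pi : 'S_(size s), perm_word _ pi = s.
Proof.
move=> std; have us : uniq s by rewrite (perm_uniq std) iota_uniq.
have lt (i : 'I_(size s)) : nth 0 s i < size s.
  by apply: stdword_lt => //; rewrite mem_nth.
have inj : injective (fun i => Ordinal (lt i)).
  by move=> i j /(congr1 val) /= /eqP; rewrite nth_uniq // => /eqP/val_inj.
exists (perm inj); apply: (@eq_from_nth _ 0); rewrite size_perm_word // => i il.
by rewrite -[i]/(val (Ordinal il)) nth_perm_word permE.
Qed.
End Permutations.

(** * Occurrences of 21-3-...-k as descents with [m]-subsets *)

Section Occurrences.
Local Open Scope nat_scope.

Lemma size_pat213 m : size (letters (pat213 m.+2)) = m.+2.
Proof. by rewrite /= size_iota !subSS subn0. Qed.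

Variables (m n : nat) (pi : 'S_n).
Hypothesis av : avoids132 (perm_word _ pi).

Let K := size (letters (pat213 m.+2)).
Let o0 : 'I_K := @Ordinal K 0 isT.
Let o1 : 'I_K := @Ordinal K 1 isT.

Definition descent_at (p : 'I_n) : bool :=
  (p.+1 < n) && (nth 0 (perm_word _ pi) p.+1 < nth 0 (perm_word _ pi) p).

Definition later_larger (p : 'I_n) : {set 'I_n} :=
  [set x : 'I_n | (p < x) && (pi p < pi x)].

(** A set suffices to record the letters 3, ..., k: by [later_larger_incr] their values increase
    with their positions. *)
Definition occ_data : {set 'I_n * {set 'I_n}} :=
  [set d : 'I_n * {set 'I_n} |
    descent_at d.1 & (d.2 \subset later_larger d.1) && (#|d.2| == m)].

(** [enum] lists the set in increasing order; [insubd] yields the position [d.1.+1] whenever it is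
    below [n], as at a descent. *)
Definition occ_of_data (d : 'I_n * {set 'I_n}) : {ffun 'I_K -> 'I_n} :=
  [ffun a : 'I_K => nth d.1 [:: d.1, insubd d.1 d.1.+1 & enum d.2] a].

Definition data_of_occ (i : {ffun 'I_K -> 'I_n}) : 'I_n * {set 'I_n} :=
  (i o0, [set i a | a : 'I_K & 1 < a]).

(** Otherwise [p], [x], [y] would be the positions of a 1-3-2. *)
Lemma later_larger_incr p x y :
  x \in later_larger p -> y \in later_larger p -> x < y -> pi x < pi y.
Proof.
rewrite !inE => /andP[px ppx] /andP[py ppy] xy.
have := avoids132P _ av _ _ _ px xy.
rewrite size_perm_word !nth_perm_word ltn_ord ppy /= => /(_ isT).
rewrite -leqNgt leq_eqVlt => /orP[/eqP/val_inj/perm_inj exy|//].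
by rewrite exy ltnn in xy.
Qed.

Lemma enum_ord_sorted (B : {set 'I_n}) : sorted ltn [seq val x | x <- enum B].
Proof.
have -> : enum B = [seq x <- enum 'I_n | x \in B] by rewrite !enumT.
apply: (subseq_sorted ltn_trans (s2 := iota 0 n)).
  by rewrite -val_enum_ord map_subseq // filter_subseq.
exact: iota_ltn_sorted.
Qed.

Lemma nth_enum_lt x0 (B : {set 'I_n}) a b :
  a < b -> b < #|B| -> nth x0 (enum B) a < nth x0 (enum B) b.
Proof.
rewrite cardE => ab bB; have aB := ltn_trans ab bB.
have := sorted_ltn_nth ltn_trans 0 (enum_ord_sorted B) a b.
rewrite !inE size_map => /(_ aB bB ab).
by rewrite !(nth_map x0).
Qed.

Lemma occ_of_dataP d : d \in occ_data -> occurrence pi (occ_of_data d).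
Proof.
case: d => p B; rewrite inE /= => /and3P[/andP[pn dp] BT /eqP Bm].
have qE : insubd p p.+1 = p.+1 :> nat by rewrite -[LHS]/(val _) val_insubd pn.
have piq : pi (insubd p p.+1) < pi p by rewrite -!nth_perm_word qE.
have mem a : a < m -> nth p (enum B) a \in later_larger p.
  by move=> am; apply: (fintype.subsetP BT); rewrite -mem_enum mem_nth // -cardE Bm.
(* Position [p.+1] carries a letter smaller than that at [p], so it is not in [later_larger p]. *)
have gtp a : a < m -> p.+1 < nth p (enum B) a.
  move=> /mem; rewrite inE => /andP[pa px]; rewrite ltn_neqAle pa andbT.
  apply: contraTneq px => e.
  by rewrite -leqNgt -!nth_perm_word -e ltnW.
have szK (b : 'I_K) c : val b = c.+2 -> c < m.
  by move=> e; have := ltn_ord b; rewrite e /K size_pat213 !ltnS.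
apply/occurrenceP; rewrite /occ_of_data; split=> a b; rewrite !ffunE /=.
- case ea : (val a) => [|[|a']]; case eb : (val b) => [|[|b']] //=.
  + by rewrite qE.
  + by move=> _; apply: ltnW; apply: gtp (szK b _ eb).
  + by move=> _; rewrite qE; apply: gtp (szK b _ eb).
  + by rewrite !ltnS => ab; apply: nth_enum_lt => //; rewrite Bm (szK b).
- case ea : (val a) => [|[|a']]; case eb : (val b) => [|[|b']] //=;
    rewrite ?nth_iota ?subSS ?subn0 ?(szK a _ ea) ?(szK b _ eb) //= => ab.
  + by have := mem b' (szK b _ eb); rewrite inE => /andP[].
  + by apply: ltn_trans piq _; have := mem b' (szK b _ eb); rewrite inE => /andP[].
  + apply: (@later_larger_incr p); [exact/mem/(szK a)|exact/mem/(szK b)|].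
    by apply: nth_enum_lt; rewrite ?Bm ?(szK b).
(* From index 1 on [dashes] reads [true], default included, so only the first two letters must be
   adjacent. *)
- case ea : (val a) => [|a'] -> //=.
  by rewrite nth_nseq if_same.
Qed.

Lemma occ_of_dataK d : d \in occ_data -> data_of_occ (occ_of_data d) = d.
Proof.
case: d => p B; rewrite inE /= => /and3P[_ _ /eqP Bm].
rewrite /data_of_occ ffunE /=; congr (_, _); apply/setP => x.
apply/imsetP/idP => [[a]|xB].
  rewrite inE ffunE /= => a1 ->.
  case ea: (val a) a1 => [|[|a']] //= _.
  have := ltn_ord a; rewrite ea /K size_pat213 !ltnS => am.
  by rewrite -mem_enum mem_nth // -cardE Bm.
have xlt : (index x (enum B)).+2 < K.
  by rewrite /K size_pat213 !ltnS -Bm cardE index_mem mem_enum.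
exists (Ordinal xlt); first by rewrite inE.
by rewrite ffunE /= nth_index // mem_enum.
Qed.

(** Both lists are strictly increasing with the same elements, hence equal. *)
Lemma enum_occ_tail (i : {ffun 'I_K -> 'I_n}) :
  (forall a b : 'I_K, a < b -> i a < i b) ->
  enum [set i a | a : 'I_K & 1 < a] = [seq i a | a <- drop 2 (enum 'I_K)].
Proof.
move=> h1; apply: (inj_map val_inj).
apply: (irr_sorted_eq ltn_trans ltnn); first exact: enum_ord_sorted.
  rewrite -map_comp; apply: (@homo_sorted _ _ _ (relpre val ltn)) => [a b|].
    exact: h1.
  rewrite -sorted_map map_drop val_enum_ord.
  by apply: drop_sorted; exact: iota_ltn_sorted.
have mem_tail (a : 'I_K) : (a \in drop 2 (enum 'I_K)) = (1 < a).
  rewrite -(mem_map val_inj) map_drop val_enum_ord /= drop0 mem_iota.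
  by rewrite ltn_ord andbT.
apply: eq_mem_map => x; rewrite mem_enum.
apply/imsetP/mapP => -[a]; first by rewrite inE => a1 ->; exists a; rewrite ?mem_tail.
by rewrite mem_tail => a1 ->; exists a; rewrite ?inE.
Qed.

Lemma data_of_occP i : occurrence pi i -> data_of_occ i \in occ_data.
Proof.
case/occurrenceP => h1 h2 h3.
have i1 : i o1 = (i o0).+1 :> nat by apply: h3.
have i0 (a : 'I_K) : 1 < a -> (i o0 < i a) && (pi (i o0) < pi (i a)).
  move=> a1; rewrite h1 ?(ltnW a1) //= h2 //.
  case ea: (val a) a1 => [|[|a']] //= _.
  have := ltn_ord a; rewrite ea /K size_pat213 !ltnS => am.
  by rewrite nth_iota // !subSS subn0.
rewrite inE /=; apply/and3P; split.
- have : pi (i o1) < pi (i o0) by apply: h2.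
  by rewrite /descent_at -i1 !nth_perm_word ltn_ord.
- by apply/fintype.subsetP => _ /imsetP[a + ->]; rewrite !inE; apply: i0.
- rewrite cardE enum_occ_tail // size_map size_drop size_enum_ord.
  by rewrite /K size_pat213 !subSS subn0.
Qed.

Lemma data_of_occK i : occurrence pi i -> occ_of_data (data_of_occ i) = i.
Proof.
case/occurrenceP => h1 h2 h3.
have i1 : i o1 = (i o0).+1 :> nat by apply: h3.
apply/ffunP => a; rewrite ffunE /= enum_occ_tail //.
case ea : (val a) => [|[|a']] /=.
- by congr (i _); apply: val_inj.
- have -> : a = o1 by apply: val_inj.
  by apply: val_inj; rewrite val_insubd -i1 ltn_ord.
have aK := ltn_ord a; rewrite ea in aK.
rewrite (nth_map a) ?size_drop ?size_enum_ord ?ltn_subRL ?add2n //.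
congr (i _).
by apply: val_inj; rewrite nth_drop add2n -ea nth_ord_enum.
Qed.

Lemma nb_occ_pat213 : nb_occ (pat213 m.+2) pi = weight m 0 (perm_word _ pi).
Proof.
have <- : #|occ_data| = nb_occ (pat213 m.+2) pi.
  rewrite /nb_occ -[RHS](card_in_imset (f := data_of_occ)); last first.
    move=> i i'; rewrite !inE => oi oi' e.
    by rewrite -(data_of_occK _ oi) e data_of_occK.
  apply: eq_card => d; apply/idP/imsetP => [hd|[i]].
    exists (occ_of_data d); last by rewrite occ_of_dataK.
    by rewrite inE occ_of_dataP.
  by rewrite inE => /data_of_occP ? ->.
(* The pairs are counted over each [p]: a descent admits all [m]-subsets of its later larger
   positions. *)
pose P p (B : {set 'I_n}) := (B \subset later_larger p) && (#|B| == m).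
rewrite -sum1dep_card -(pair_big_dep _ P (fun _ _ => 1)) /=.
rewrite weightE size_perm_word big_mkcond /=; apply: eq_bigr => p _.
rewrite -/(descent_at p); case: (descent_at p) => //; rewrite mul1n add0n.
have -> : \sum_(B : {set 'I_n} | (B \subset later_larger p) && (#|B| == m)) 1
    = 'C(#|later_larger p|, m).
  rewrite sum1dep_card -cards_draws; apply: eq_card => B.
  by rewrite !inE.
congr 'C(_, m); rewrite -val_enum_ord count_map cardE.
rewrite [in LHS]/enum_mem size_filter -enumT; apply: eq_count => x.
by rewrite /= !nth_perm_word inE.
Qed.

End Occurrences.

(** [perm_word] is a bijection onto the standard words of size [n]. Leaving [h] free lets one list
    serve all [n <= h]. *)
Lemma f_pat213E m r n h : (n <= h)%N ->
  f_ (pat213 m.+2) r n =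
    count (fun s => (size s == n) && (weight m 0 s == r)) (avoiders h).
Proof.
move=> nh; rewrite /f_ cardE -(size_map (perm_word n)) -size_filter.
apply/perm_size/uniq_perm.
- rewrite map_inj_uniq ?enum_uniq //; exact: perm_word_inj.
- by rewrite filter_uniq ?avoiders_uniq.
move=> s; rewrite mem_filter; apply/mapP/idP => [[pi]|].
  rewrite mem_enum inE => /andP[av /eqP <-] ->.
  rewrite size_perm_word eqxx mem_avoiders ?size_perm_word // stdword_perm_word.
  by rewrite avoids_pat132E in av; rewrite nb_occ_pat213 // eqxx.
case/andP => /andP[/eqP sn /eqP wr].
rewrite mem_avoiders ?sn // => /andP[std av].
have [pi piE] := perm_word_surj _ std; move: pi piE; rewrite sn => pi piE.
exists pi => //.
by rewrite mem_enum inE avoids_pat132E piE av nb_occ_pat213 piE // wr eqxx.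
Qed.

(** * Truncated generating functions and their recursion *)

Section GeneratingFunction.
Variable R : comNzRingType.
Implicit Types (m j h i r n : nat).

(* [redU i] at [x] is [x^(i/2) U_i(1 / (2 sqrt x))], see [horner_redU]. *)
Fixpoint redU i : {poly R} :=
  if i is i'.+1 then
    if i' is i''.+1 then redU i' - 'X * redU i'' else 1
  else 1.

Lemma redUSS i : redU i.+2 = redU i.+1 - 'X * redU i.
Proof. by []. Qed.

Lemma redU_coef0 i : (redU i)`_0 = 1.
Proof.
suff [] : (redU i)`_0 = 1 /\ (redU i.+1)`_0 = 1 by [].
elim: i => [|i [IH1 IH2]]; first by rewrite coefC.
by rewrite redUSS coefB coefXM subr0.
Qed.

(** The recurrence multiplies the left side by ['X] when [i] grows by one. *)
Lemma redU_turan i : redU i.+1 ^+ 2 - redU i * redU i.+2 = 'X^(i.+1).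
Proof.
elim: i => [|i IH]; first by rewrite /= expr1; ring.
by rewrite [in RHS]exprS -IH !redUSS; ring.
Qed.

Notation x := ('X : {poly R})%:P.

(* The outer variable ['X] marks the weight, the inner one [x] the size. *)
Definition gf m j h : {poly {poly R}} :=
  \sum_(s <- avoiders h) ('X^(size s))%:P * 'X^(weight m j s).

(** This is the factor of the part after the maximum: only the empty word, which contributes 1,
    escapes the extra ['X^c]. *)
Lemma gf_tail m j c h :
  \sum_(s <- avoiders h)
     ('X^(size s))%:P * 'X^((s != [::]) * c + weight m j s)
  = 1 + 'X^c * (gf m j h - 1).
Proof.
rewrite /gf; case: h => [|h] /=; rewrite !big_cons ?big_nil /= ?mul1r ?expr0.
  by ring.
rewrite [1 + _ - 1]addrC addKr mulr_sumr; congr (_ + _); apply: eq_big_seq => s.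
by case/allpairsP => -[l r] [_ _ ->]; rewrite -size_eq0 size_glue mul1n exprD; ring.
Qed.

(** The equation is exact despite truncation, since [avoiders h.+1] glues all pairs from
    [avoiders h]. *)
Lemma gfS m j h :
  gf m j h.+1 = 1 + x * gf m j.+1 h * (1 + 'X^'C(j, m) * (gf m j h - 1)).
Proof.
rewrite -gf_tail /gf [in LHS]/= big_cons /= mul1r expr0; congr (_ + _).
rewrite (big_allpairs_dep (r2 := fun=> avoiders h)) -mulrA mulr_suml mulr_sumr.
apply: eq_big_seq => l hl.
rewrite !mulr_sumr; apply: eq_big_seq => r hr.
have [/andP[sl _] /andP[sr _]] := (avoiders_valid _ _ hl, avoiders_valid _ _ hr).
rewrite size_glue weight_glue // -addnA exprD exprS exprD !polyCM; ring.
Qed.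

(** For [j > m] the binomial is at least ['C(m.+1, m) = m.+1], so its term vanishes modulo
    ['X^(m.+1)] and each step gains a factor [x]. *)
Lemma gf_high m j h : (0 < m)%N -> (m < j)%N ->
  exists a b, (1 - x) * gf m j h = 1 + a * x ^+ h + b * 'X^(m.+1).
Proof.
move=> m0; elim: h j => [|h IH] j mj.
  (* Modulo [x ^+ 0 = 1] everything is congruent, so the witness is the whole difference. *)
  by exists ((1 - x) * gf m j 0 - 1), 0; ring.
have [a [b e]] := IH j.+1 (ltnW mj).
have mc : (m.+1 <= 'C(j, m))%N by rewrite -{1}(binSn m) leq_bin2l.
exists a, (x * b + (1 - x) * x * gf m j.+1 h * 'X^('C(j, m) - m.+1) * (gf m j h - 1)).
rewrite gfS -{1}(subnK mc) exprD.
transitivity ((1 - x) + x * ((1 - x) * gf m j.+1 h) +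
  (1 - x) * x * gf m j.+1 h * 'X^('C(j, m) - m.+1) * 'X^(m.+1) * (gf m j h - 1)).
  by ring.
by rewrite e (exprS x); ring.
Qed.

(** Modulo ['X^(m.+1)], the series for [j = m - i] is [den i / den i.+1]. *)
Definition den i : {poly {poly R}} := (redU i.+1)%:P - x * 'X * (redU i)%:P.

Lemma denSS i : den i.+2 = den i.+1 - x * den i.
Proof. by rewrite /den !redUSS !polyCB !polyCM; ring. Qed.

(* The witnesses [a] and [b] express a congruence modulo [x^h] and ['X^(m+1)];
   the first modulus is needed because [gf] is truncated. *)
Lemma gf_low m i h : (0 < m)%N -> (i <= m)%N ->
  exists a b, den i.+1 * gf m (m - i) h = den i + a * x ^+ h + b * 'X^(m.+1).
Proof.
move=> m0; elim: h i => [|h IH] i im.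
  by exists (den i.+1 * gf m (m - i) 0 - den i), 0; ring.
have [a [b e]] := IH i im.
case: i im e => [|i] im e.
  (* For [j = m] the binomial is 1, and [gf_high] supplies the series for [m.+1]. *)
  have [a' [b' e']] := gf_high m m.+1 h m0 (ltnSn m).
  rewrite subn0 in e *; rewrite gfS binn expr1.
  exists ('X * gf m m.+1 h * a + a'), (x * 'X * gf m m.+1 h * b + x * b').
  set G := gf m m h in e *; set G' := gf m m.+1 h in e' *.
  transitivity (den 1 + x * G' * ((1 - 'X) * den 1) + x * 'X * G' * (den 1 * G)).
    by ring.
  transitivity (den 1 + x * ((1 - x) * G') - x * 'X * G' * den 0
                + x * 'X * G' * (den 1 * G)).
    by rewrite /den /= mulr1 !polyCB polyC1; ring.
  by rewrite e e' (exprS x) /den /= mulr1 !polyCB polyC1; ring.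
(* For [j < m] the binomial is 0, so the equation is [G = 1 + x G' G], and [denSS] closes the
   induction. *)
have [a' [b' e']] := IH i (ltnW im).
exists (gf m (m - i) h * a + a'), (x * gf m (m - i) h * b + x * b').
rewrite gfS subnSK // bin_small ?ltn_subrL ?m0 // expr0.
set G := gf m (m - i.+1) h in e *; set G' := gf m (m - i) h in e' *.
transitivity (den i.+2 + x * G' * (den i.+2 * G)); first by ring.
rewrite e; transitivity (den i.+2 + x * (den i.+1 * G')
  + x * G' * (a * x ^+ h + b * 'X^(m.+1))); first by ring.
by rewrite e' (exprS x) denSS; ring.
Qed.

Arguments redU : simpl never.

(** Compare coefficients of ['X^r] in [den m.+1 * G = den m]; the linear term of [den m] shows up
    only at [r = 1]. *)
Lemma coef_gf m h r : (0 < m)%N -> (r <= m)%N ->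
  exists a : {poly R},
    redU m.+2 * (gf m 0 h)`_r =
      (if r is r'.+1 then 'X * redU m.+1 * (gf m 0 h)`_r' else redU m.+1)
      - (if r == 1 then 'X * redU m else 0) + a * 'X^h.
Proof.
move=> m0 rm; have [a [b]] := gf_low m m h m0 (leqnn m).
rewrite subnn; set G := gf m 0 h => e; exists a`_r.
have : (den m.+1 * G)`_r = (den m + a * x ^+ h + b * 'X^(m.+1))`_r by rewrite e.
rewrite /den !coefD coefMXn ltnS rm addr0 -polyC_exp coefMC.
have -> i (p : {poly {poly R}}) : ((redU i.+1)%:P - x * 'X * (redU i)%:P) * p
   = (redU i.+1)%:P * p - ('X * redU i)%:P * ('X * p) by rewrite polyCM; ring.
have -> i : x * 'X * (redU i)%:P = ('X * redU i)%:P * 'X by rewrite polyCM; ring.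
rewrite coefB !coefCM coefN coefCM coefX coefC coefXM.
case: r rm => [|[|r]] _ /=; rewrite ?mulr0 ?mulr1 ?mul0r => /eqP.
- by rewrite !subr0 => /eqP.
- rewrite subr_eq => /eqP ->; ring.
- rewrite subr_eq => /eqP ->; ring.
Qed.

Lemma coef0_gf m h : (0 < m)%N ->
  exists a : {poly R}, redU m.+2 * (gf m 0 h)`_0 = redU m.+1 + a * 'X^h.
Proof.
move=> m0; have [a e] := coef_gf m h 0 m0 isT.
by exists a; rewrite e subr0.
Qed.

(** The coefficient at 1 comes from [redU_turan]; each later one is the previous times
    ['X * redU m.+1 / redU m.+2], up to truncation. *)
Lemma coefS_gf m h r : (0 < m)%N -> (r < m)%N ->
  exists a : {poly R},
    redU m.+2 ^+ r.+2 * (gf m 0 h)`_r.+1 =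
      'X^(r + m.+2) * redU m.+1 ^+ r + a * 'X^h.
Proof.
move=> m0; elim: r => [|r IH] rm.
  have [a e] := coef_gf m h 1 m0 rm; have [b e0] := coef0_gf m h m0.
  exists ('X * redU m.+1 * b + redU m.+2 * a).
  rewrite expr2 -mulrA e /= [LHS](_ : _ = 'X * redU m.+1 * (redU m.+2 * (gf m 0 h)`_0)
    - 'X * redU m * redU m.+2 + redU m.+2 * a * 'X^h); last by ring.
  by rewrite e0 add0n exprS -redU_turan; ring.
have [a e] := coef_gf m h r.+2 m0 rm; have [b e0] := IH (ltnW rm).
exists ('X * redU m.+1 * b + redU m.+2 ^+ r.+2 * a).
rewrite exprSr -mulrA e /= subr0.
rewrite [LHS](_ : _ = 'X * redU m.+1 * (redU m.+2 ^+ r.+2 * (gf m 0 h)`_r.+1)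
    + redU m.+2 ^+ r.+2 * a * 'X^h); last by ring.
by rewrite e0 addSn !exprS; ring.
Qed.

Lemma coef_coef_gf m r n h : (n <= h)%N ->
  (gf m 0 h)`_r`_n = (f_ (pat213 m.+2) r n)%:R.
Proof.
move=> nh; rewrite (f_pat213E _ _ _ _ nh) -sum1_count natr_sum.
rewrite /gf !coef_sum [RHS]big_mkcond; apply: eq_bigr => s _.
rewrite coefCM coefXn [r == _]eq_sym [_ == n]eq_sym.
by case: eqP => _; rewrite ?andbF ?mulr0 ?coef0 // mulr1 coefXn andbT; case: eqP.
Qed.

End GeneratingFunction.

(** The [n]-th coefficient is read off at [h = n.+1], where truncation no longer affects it. *)
Lemma fps_quotient_gf (R : realType) m r (P Q : {poly R}) : Q`_0 != 0 ->
  (forall h, exists a, Q * (gf R m 0 h)`_r = P + a * 'X^h) ->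
  fps_quotient (f_ (pat213 m.+2) r) P Q.
Proof.
move=> Q0 e; split=> // n; have [a /(congr1 (fun p : {poly R} => p`_n))] := e n.+1.
rewrite coefD coefMXn ltnSn addr0 coefM => <-.
by apply: eq_bigr => i _; rewrite coef_coef_gf // (leq_trans (leq_subr _ _)).
Qed.

(** * Chebyshev polynomials and their rescaling *)

Section Chebyshev.
Variable R : realType.

(** The polynomials agree at the distinct points [1/(i+2)], cosines of angles with nonzero sine; as
    many as [size (p - q)] force equality. This transfers the recurrence to the chosen
    [chebyshevU]. *)
Lemma is_chebyshevU_inj j (p q : {poly R}) :
  is_chebyshevU j p -> is_chebyshevU j q -> p = q.
Proof.
move=> hp hq; apply/eqP; rewrite -subr_eq0; apply/eqP.
pose rs := mkseq (fun i => i.+2%:R^-1 : R) (size (p - q)).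
apply: (@roots_geq_poly_eq0 _ _ rs); last by rewrite size_mkseq.
  apply/allP => _ /mapP[i _ ->]; rewrite /root hornerD hornerN.
  set t : R := _^-1.
  have t0 : 0 < t by rewrite invr_gt0.
  have t1 : t < 1 by rewrite invf_lt1 // ltr1n.
  have tb : -1 <= t <= 1 by rewrite (ltW t1) (le_trans _ (ltW t0)) // lerN10.
  have st : sin (acos t) != 0.
    rewrite sin_acos // sqrtr_eq0 -ltNge subr_gt0 expr2.
    by rewrite mulr_ilt1 ?ltW.
  by have := hp _ st; have := hq _ st; rewrite acosK // => -> ->; rewrite subrr.
rewrite /rs mkseq_uniq // => i i' /invr_inj /eqP.
by rewrite eqr_nat => /eqP[].
Qed.

Lemma chebyshevU0 : chebyshevU R 0 = 1.
Proof.
apply: is_chebyshevU_inj; first exact: chebyshevUP.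
move=> t st.
by rewrite hornerC mul1r divff.
Qed.

Lemma chebyshevU1 : chebyshevU R 1 = 'X *+ 2.
Proof.
apply: is_chebyshevU_inj; first exact: chebyshevUP.
move=> t st.
by rewrite hornerMn hornerX mulr_natl sin_mulr2n -mulrnAl mulfK.
Qed.

Lemma chebyshevUSS j :
  chebyshevU R j.+2 = 'X *+ 2 * chebyshevU R j.+1 - chebyshevU R j.
Proof.
apply: is_chebyshevU_inj; first exact: chebyshevUP.
move=> t st.
rewrite hornerD hornerN hornerM hornerMn hornerX !chebyshevUP //.
apply: (mulIf st); rewrite mulrBl -!mulrA mulVf // !mulr1.
have -> : j.+3%:R * t = j.+2%:R * t + t by rewrite -addn1 natrD mulrDl mul1r.
have -> : j.+1%:R * t = j.+2%:R * t - t.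
  by rewrite -[j.+2]addn1 natrD mulrDl mul1r addrK.
by rewrite !sinD sinN cosN; ring.
Qed.

(** With [s = sqrt x], multiplying [U_(i+2) = (1/s) U_(i+1) - U_i] by [s^(i+2)] gives the recurrence
    of [redU]. *)
Lemma horner_redU i (x : R) : 0 < x ->
  (redU R i).[x] = Num.sqrt x ^+ i * U_at i x.
Proof.
move=> x0; have s0 : Num.sqrt x != 0 by rewrite sqrtr_eq0 -ltNge.
suff [] : (redU R i).[x] = Num.sqrt x ^+ i * U_at i x /\
          (redU R i.+1).[x] = Num.sqrt x ^+ i.+1 * U_at i.+1 x by [].
rewrite /U_at; elim: i => [|i [IH1 IH2]].
  rewrite chebyshevU0 chebyshevU1 hornerMn hornerX !hornerC.
  by split; [ring|field].
split=> //; rewrite redUSS chebyshevUSS.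
rewrite !(hornerD, hornerN, hornerM, hornerMn, hornerX).
rewrite IH1 IH2; have := sqr_sqrtr (ltW x0).
move: (Num.sqrt x) s0 (_.[_]) (_.[_]) => s s0 u v <-; rewrite !exprS.
by field.
Qed.

Lemma powR_half (x : R) n : 0 <= x -> x `^ (n%:R / 2) = Num.sqrt x ^+ n.
Proof.
by move=> x0; rewrite mulrC powRrM powR12_sqrt // powR_mulrn // sqrtr_ge0.
Qed.
End Chebyshev.

(** * Closed forms at positive arguments *)

Theorem theorem2p16 (R : realType) (k : nat) (hk : (3 <= k)%N) :
  (forall r : nat, (1 <= r <= k - 2)%N ->
     genfun_eq (f_ (pat213 k) r)
       (fun x : R => U_at k x != 0)
       (fun x : R =>
          x `^ ((r%:R - 1) / 2) * U_at (k - 1) x ^+ (r - 1)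
            / U_at k x ^+ (r + 1))) /\
  genfun_eq (f_ (pat213 k) 0)
    (fun x : R => U_at k x != 0)
    (fun x : R => U_at (k - 1) x / (Num.sqrt x * U_at k x)).
Proof.
case: k hk => [|[|m]] // m0; have {}m0 : (0 < m)%N by [].
have Q0 r : (redU R m.+2 ^+ r)`_0 != 0.
  by rewrite -horner_coef0 horner_exp horner_coef0 redU_coef0 expr1n oner_eq0.
split=> [[|r] // /andP[_ rm]|].
  rewrite !subSS subn0 in rm; rewrite !subSS !subn0 addn1.
  exists ('X^(r + m.+2) * redU R m.+1 ^+ r), (redU R m.+2 ^+ r.+2); split.
    by apply: fps_quotient_gf => // h; apply: coefS_gf.
  move=> x x0 Ux; have s0 : Num.sqrt x != 0 by rewrite sqrtr_eq0 -ltNge.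
  rewrite horner_exp hornerM !horner_exp hornerX !horner_redU //.
  have Q0x : (Num.sqrt x ^+ m.+2 * U_at m.+2 x) ^+ r.+2 != 0.
    by apply: expf_neq0; apply: mulf_neq0 => //; apply: expf_neq0.
  split=> //.
  have -> : r.+1%:R - 1 = r%:R :> R by rewrite -addn1 natrD addrK.
  rewrite powR_half ?ltW //.
  apply/eqP; rewrite eqr_div //; last exact: expf_neq0.
  apply/eqP.
  have -> : x ^+ (r + m.+2) = Num.sqrt x ^+ (2 * (r + m.+2)).
    by rewrite exprM sqr_sqrtr // ltW.
  rewrite (exprMn _ (Num.sqrt x ^+ m.+1)) (exprMn _ (Num.sqrt x ^+ m.+2)).
  rewrite -(exprM _ m.+1) -(exprM _ m.+2).
  transitivity (Num.sqrt x ^+ (2 * (r + m.+2) + m.+1 * r) *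
                (U_at m.+1 x ^+ r * U_at m.+2 x ^+ r.+2)).
    by rewrite exprD -!mulrA.
  (* Powers of [sqrt x]: after cancelling those of the denominator [r] remain, that is [x^(r/2)],
     with [r] one below the number of occurrences. *)
  have -> : (2 * (r + m.+2) + m.+1 * r = r + m.+2 * r.+2)%N by lia.
  by rewrite (exprD _ r) mulrACA.
exists (redU R m.+1), (redU R m.+2); split.
  apply: fps_quotient_gf; first by rewrite -[redU _ _]expr1.
  by move=> h; apply: coef0_gf.
move=> x x0 Ux; have s0 : Num.sqrt x != 0 by rewrite sqrtr_eq0 -ltNge.
rewrite !horner_redU // subSS subn0; split.
  by apply: mulf_neq0 => //; apply: expf_neq0.
by rewrite (exprS _ m.+1); field; rewrite Ux s0 expf_neq0.
Qed.
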